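(* Suppose that the uncertainty set is a polytope of the form $\Xi=\{\xi\in\mathbb{R}^m:C\xi\le d\}$, where $C$ is a matrix and $d$ a vector of appropriate dimensions, and let $\varepsilon\ge0$. (i) If $\mathbb{A}=\{\xi\in\mathbb{R}^m:A\xi<b\}$ is an open polytope and the halfspace $\{\xi:\langle a_k,\xi\rangle\ge b_k\}$ has a nonempty intersection with $\Xi$ for any $k\le K$, where $a_k$ is the $k$-th row of the matrix $A$ and $b_k$ is the $k$-th entry of the vector $b$ ($A$ having $K$ rows), then the worst-case probability $\sup_{\mathbb{Q}\in\mathbb{B}_\varepsilon(\widehat{\mathbb{P}}_N)}\mathbb{Q}[\xi\notin\mathbb{A}]$ is given by $$\begin{array}{cll}\inf\limits_{\lambda,s_i,\gamma_{ik},\theta_{ik}}&\lambda\varepsilon+\frac1N\sum\limits_{i=1}^Ns_i&\\ \text{s.t.}&1-\theta_{ik}\big(b_k-\langle a_k,\widehat\xi_i\rangle\big)+\langle\gamma_{ik},d-C\widehat\xi_i\rangle\le s_i&\forall i\le N,\ \forall k\le K\\ &\|a_k\theta_{ik}-C^\top\gamma_{ik}\|_*\le\lambda&\forall i\le N,\ \forall k\le K\\ &\gamma_{ik}\ge0&\forall i\le N,\ \forall k\le K\\ &\theta_{ik}\ge0&\forall i\le N,\ \forall k\le K\\ &s_i\ge0&\forall i\le N.\end{array}$$ (ii) If $\mathbb{A}=\{\xi\in\mathbb{R}^m:A\xi\le b\}$ is a closed polytope that has a nonempty intersection with $\Xi$, then the best-case probability $\sup_{\mathbb{Q}\in\mathbb{B}_\varepsilon(\widehat{\mathbb{P}}_N)}\mathbb{Q}[\xi\in\mathbb{A}]$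 is given by $$\begin{array}{cll}\inf\limits_{\lambda,s_i,\gamma_i,\theta_i}&\lambda\varepsilon+\frac1N\sum\limits_{i=1}^Ns_i&\\ \text{s.t.}&1+\langle\theta_i,b-A\widehat\xi_i\rangle+\langle\gamma_i,d-C\widehat\xi_i\rangle\le s_i&\forall i\le N\\ &\|A^\top\theta_i+C^\top\gamma_i\|_*\le\lambda&\forall i\le N\\ &\gamma_i\ge0&\forall i\le N\\ &\theta_i\ge0&\forall i\le N\\ &s_i\ge0&\forall i\le N.\end{array}$$
   Context: Notation: $\langle a,b\rangle=a^\top b$; $\|\cdot\|$ is an arbitrary norm on $\mathbb{R}^m$ with dual norm $\|z\|_*=\sup_{\|\xi\|\le1}\langle z,\xi\rangle$; vector inequalities are componentwise; rows $a_k$ are viewed as vectors in $\mathbb{R}^m$. $\lambda$, $s_i$ and $\theta_{ik}$ are real; $\gamma_{ik},\gamma_i,\theta_i$ are real vectors of matching dimension. Data and ball: $\widehat\xi_1,\dots,\widehat\xi_N\in\Xi$ are given points and $\widehat{\mathbb{P}}_N=\frac1N\sum_{i=1}^N\delta_{\widehat\xi_i}$. $\mathcal{M}(\Xi)$ is the set of probability distributions $\mathbb{Q}$ supported on $\Xi$ with $\mathbb{E}^{\mathbb{Q}}[\|\xi\|]<\infty$; $d_{\mathrm W}(\mathbb{Q}_1,\mathbb{Q}_2)=\inf_\Pi\int_{\Xi^2}\|\xi_1-\xi_2\|\,\Pi(d\xi_1,d\xi_2)$ over joint distributions $\Pi$ with marginals $\mathbb{Q}_1,\mathbb{Q}_2$;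 $\mathbb{B}_\varepsilon(\widehat{\mathbb{P}}_N)=\{\mathbb{Q}\in\mathcal{M}(\Xi):d_{\mathrm W}(\widehat{\mathbb{P}}_N,\mathbb{Q})\le\varepsilon\}$. *)

(* Defs.v *)
From HB Require Import structures.
From mathcomp Require Import all_boot all_order all_algebra.
From mathcomp Require Import all_classical all_reals all_analysis.
Set Implicit Arguments.
Unset Strict Implicit.
Unset Printing Implicit Defensive.
Import Order.TTheory GRing.Theory Num.Theory.
Import numFieldNormedType.Exports.
Local Open Scope classical_set_scope.
Local Open Scope ring_scope.

(* R^m with its Borel sigma-algebra; elements are convertible to column
   vectors. *)
Notation borel_cV R m := (g_sigma_algebraType (@open 'cV[R]_m)).

Definition dotv (R : realType) (m : nat) (x y : 'cV[R]_m) : R :=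
  (x^T *m y) 0 0.

Definition lev (R : realType) (n : nat) (x y : 'cV[R]_n) : Prop :=
  forall i, x i 0 <= y i 0.

Definition ltv (R : realType) (n : nat) (x y : 'cV[R]_n) : Prop :=
  forall i, x i 0 < y i 0.

Definition rowv (R : realType) (p m : nat) (A : 'M[R]_(p, m)) (k : 'I_p) :
  'cV[R]_m := (row k A)^T.

Definition closed_polytope (R : realType) (p m : nat) (A : 'M[R]_(p, m))
    (b : 'cV[R]_p) : set 'cV[R]_m :=
  [set x | lev (A *m x) b].

Definition open_polytope (R : realType) (p m : nat) (A : 'M[R]_(p, m))
    (b : 'cV[R]_p) : set 'cV[R]_m :=
  [set x | ltv (A *m x) b].

(* The norm is a parameter, unrelated to the canonical (sup) norm `|x| on
   'cV[R]_m; nonnegativity follows from the three axioms. *)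
Record is_norm (R : realType) (m : nat) (nrm : 'cV[R]_m -> R) : Prop :=
  IsNorm {
    is_norm_triangle : forall x y, nrm (x + y) <= nrm x + nrm y;
    is_norm_scale : forall (a : R) x, nrm (a *: x) = `|a| * nrm x;
    is_norm_definite : forall x, nrm x = 0 -> x = 0 }.

(* Extended-real-valued so that the supremum has no default value. *)
Definition dual_norm (R : realType) (m : nat) (nrm : 'cV[R]_m -> R)
    (z : 'cV[R]_m) : \bar R :=
  ereal_sup [set (dotv z x)%:E | x in [set x | nrm x <= 1]].

Section empirical_measure.
Context d (T : measurableType d) (R : realType) (N : nat) (x : 'I_N -> T).
Local Open Scope ereal_scope.

Definition empirical (A : set T) : \bar R :=
  (N%:R^-1)%:E * \sum_(i < N) \d_(x i) A.

Let empirical0 : empirical set0 = 0.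
Proof. by rewrite /empirical big1 ?mule0// => i _; rewrite measure0. Qed.

Let empirical_ge0 A : 0 <= empirical A.
Proof. by rewrite mule_ge0 ?lee_fin ?invr_ge0// sume_ge0. Qed.

Let empirical_sigma_additive : semi_sigma_additive empirical.
Proof.
pose m_ (k : nat) : {measure set T -> \bar R} :=
  if insub k is Some i then dirac (x i) else mzero.
have N0 : (0 <= N%:R^-1 :> R)%R by rewrite invr_ge0.
have -> : empirical = mscale (NngNum N0) (msum m_ N).
  apply/funext => A; rewrite /empirical /mscale /msum/=; congr (_ * _).
  by apply: eq_bigr => i _; rewrite /m_ valK.
exact: measure_semi_sigma_additive.
Qed.

HB.instance Definition _ := isMeasure.Build _ _ _ empirical
  empirical0 empirical_ge0 empirical_sigma_additive.

Lemma empirical_setT : (0 < N)%N -> empirical setT = 1.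
Proof.
move=> N0; rewrite /empirical.
rewrite (eq_bigr (fun=> 1%:E)) => [|i _]; last by rewrite diracT.
rewrite sumEFin -EFinM big_const_ord iter_addr_0 mulVf//.
by rewrite pnatr_eq0 -lt0n.
Qed.

End empirical_measure.
Arguments empirical {d T} R {N} x.

Section wasserstein.
Context (R : realType) (m : nat).
Variables (nrm : 'cV[R]_m -> R) (Xi : set 'cV[R]_m).
Local Notation T := (borel_cV R m).
Local Open Scope ereal_scope.

(* Measures are only constrained on measurable sets, hence the restriction to
   those in the marginal conditions. *)
Definition coupling (mu nu : {measure set T -> \bar R}) :
    set (probability (T * T)%type R) :=
  [set Pi | forall A : set T, measurable A ->
    Pi (A `*` setT) = mu A /\ Pi (setT `*` A) = nu A].

Definition wasserstein (mu nu : {measure set T -> \bar R}) : \bar R :=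
  ereal_inf [set \int[Pi]_(z in Xi `*` Xi)
                   (nrm ((z.1 : 'cV[R]_m) - (z.2 : 'cV[R]_m))%R)%:E
            | Pi in coupling mu nu].

Definition finite_mean_on : set (probability T R) :=
  [set Q : probability T R | Q Xi = 1 /\ \int[Q]_x (nrm x)%:E < +oo].

Definition wasserstein_ball (mu : {measure set T -> \bar R}) (eps : R) :
    set (probability T R) :=
  [set Q : probability T R | finite_mean_on Q /\ wasserstein mu Q <= eps%:E].

End wasserstein.

(* Main.v *)
Require Import Defs.
From HB Require Import structures.
From mathcomp Require Import all_boot all_order all_algebra.
From mathcomp Require Import all_classical all_reals all_analysis.
From mathcomp Require Import measurable_realfun lra ring.
Import Order.TTheory GRing.Theory Num.Theory.
Import numFieldNormedType.Exports HBNNSimple.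
Local Open Scope classical_set_scope.
Local Open Scope ring_scope.
Set Implicit Arguments.
Unset Strict Implicit.
Unset Printing Implicit Defensive.

(** Both parts are one statement about a closed event F with F `&` Xi nonempty,
    F being the union of finitely many polyhedra: the halfspaces
    <a_k, xi> >= b_k in the first part, the polytope itself in the second
    ([worst_case_probability]).

    Let D_i be the distance from xihat_i to F `&` Xi.  To increase the
    probability of F, an adversary moves a fraction alpha_i of the i-th atom to
    the nearest point of F `&` Xi; this costs D_i per unit of mass.  The worst
    case is thus the fractional knapsack problem: maximise the average of the
    alpha_i in [0, 1] subject to the average of D_i alpha_i being at most eps.
    Its linear programming dual has a price lambda >= 0 of transport and
    s_i >= 0 with 1 <= s_i + lambda D_i, that is,
      1 <= s_i + lambda * nrm (xi - xihat_i)   for all xi in F `&` Xi.    (1)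
    That no distribution in the ball does better than a pair (lambda, s) with
    (1) follows by integrating (1) against an almost optimal coupling
    ([weak_duality]).  Conversely, every feasible alpha gives a finitely
    supported distribution in the ball ([transport_plan]), so the supremum
    bounds the knapsack problem, and the Farkas lemma produces a pair
    (lambda, s) with (1) of value at most the supremum
    ([knapsack_duality], [strong_duality]).  Distances to F `&` Xi are attained
    ([nearest_point]), so that this also covers eps = 0.

    It remains to see that for a polyhedron P = {x | M x <= h} `&` Xi, the
    semi-infinite condition (1) on P holds exactly when multipliers theta and
    gamma exist.  Multipliers give (1) by weighting the inequalities of P
    ([certificate_sound]).  In the other direction, (1) says that a constant is
    dominated by the sublinear function lambda * nrm on the convex set
    P - xihat_i; by the Mazur-Orlicz theorem, a linear form z below
    lambda * nrm still dominates it ([mazur_orlicz]).  The resulting affine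
    inequality is valid on P, hence a nonnegative combination of the
    inequalities defining P ([affine_farkas]), whose weights are theta and
    gamma ([certificate_complete]). *)

(** * The Farkas lemma *)

Lemma scalarB (R : pzRingType) (V : lmodType R) (f : V -> R) (t : R) (x y : V) :
  scalar f -> f (x - t *: y) = f x - t * f y.
Proof. by move=> lf; rewrite addrC -scaleNr lf mulNr addrC. Qed.

Lemma scalar0 (R : pzRingType) (V : lmodType R) (f : V -> R) :
  scalar f -> f 0 = 0.
Proof.
by move=> lf; have := scalarB 1 0 0 lf; rewrite scaler0 subrr mul1r subrr.
Qed.

(** Induction on the number of forms.  If dropping the first form f breaks the
    implication, some x' has c x' > 0, f x' > 0 and nonpositive values on the
    other forms; projecting along x' onto the kernel of f eliminates f, and the
    signs of the values at x' make the recovered weight of f nonnegative. *)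
Lemma farkas (R : realFieldType) (V : lmodType R) (n : nat)
    (a : 'I_n -> V -> R) (c : V -> R) :
  (forall j, scalar (a j)) -> scalar c ->
  (forall x, (forall j, a j x <= 0) -> c x <= 0) ->
  exists2 y : 'I_n -> R, (forall j, 0 <= y j) &
    forall x, c x = \sum_j y j * a j x.
Proof.
elim: n => [|n IHn] in a c * => la lc ac.
  exists (fun=> 0) => // x; rewrite big_ord0; apply/eqP; rewrite eq_le.
  have cle z : c z <= 0 by apply: ac => -[].
  have := cle (0 - 1 *: x).
  by rewrite scalarB// (scalar0 lc) mul1r sub0r oppr_le0 cle.
set f := a ord0; pose a' j := a (lift ord0 j).
have [Hc|/existsNP[x' /not_implyP[ax' /negP]]] :=
    pselect (forall x, (forall j, a' j x <= 0) -> c x <= 0).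
  have [y y0 cE] := IHn a' c (fun j => la _) lc Hc.
  exists (fun j => oapp y 0 (unlift ord0 j)) => [j|x].
    by case: unliftP => [k _|_] /=.
  rewrite big_ord_recl unlift_none mul0r add0r cE.
  by apply: eq_bigr => j _; rewrite liftK.
rewrite -ltNge => cx'.
have fx' : 0 < f x'.
  rewrite ltNge; apply/negP => fx'; move: cx'; rewrite ltNge ac// => j.
  by case: (unliftP ord0 j) => [k ->|->]; [exact: ax'|].
pose r g := g x' / f x'.
(* g - r g * f is the form g precomposed with the projection along x'. *)
have [||x ax|y y0 cE] := IHn (fun j x => a' j x - r (a' j) * f x)
    (fun x => c x - r c * f x).
- by move=> j s x z /=; rewrite /a' /f !la; ring.
- by move=> s x z /=; rewrite lc /f la; ring.
- rewrite [c x - _](_ : _ = c (x - (f x / f x') *: x')).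
    apply: ac => j; rewrite scalarB; last exact: la.
    case: (unliftP ord0 j) => [k ->|->]; last first.
      by rewrite -/f divfK ?subrr// gt_eqF.
    have := ax k; congr (is_true (_ <= 0)); rewrite /r /a'; ring.
  by rewrite scalarB// /r; ring.
exists (fun j => if unlift ord0 j is Some k then y k
                 else r c - \sum_k y k * r (a' k)) => [j|x].
  case: unliftP => [k _//|_]; rewrite subr_ge0.
  apply: (@le_trans _ _ 0); last by rewrite divr_ge0// ltW.
  apply: sumr_le0 => k _; rewrite mulr_ge0_le0// mulr_le0_ge0//.
  by rewrite invr_ge0 ltW.
rewrite big_ord_recl unlift_none -/f.
have /eqP := cE x; rewrite subr_eq => /eqP ->.
rewrite mulrBl addrC -addrA; congr (_ + _); rewrite mulr_suml addrC.
rewrite -sumrB; apply: eq_bigr => j _; rewrite liftK /a'; ring.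
Qed.

Lemma dotvE (R : realType) (m : nat) (x y : 'cV[R]_m) :
  dotv x y = \sum_i x i 0 * y i 0.
Proof. by rewrite /dotv mxE; apply: eq_bigr => i _; rewrite mxE. Qed.

Lemma dotvC (R : realType) (m : nat) (x y : 'cV[R]_m) : dotv x y = dotv y x.
Proof. by rewrite !dotvE; apply: eq_bigr => i _; rewrite mulrC. Qed.

Lemma dotvDr (R : realType) (m : nat) (x y z : 'cV[R]_m) :
  dotv x (y + z) = dotv x y + dotv x z.
Proof. by rewrite /dotv mulmxDr mxE. Qed.

Lemma dotvNr (R : realType) (m : nat) (x y : 'cV[R]_m) :
  dotv x (- y) = - dotv x y.
Proof. by rewrite /dotv mulmxN mxE. Qed.

Lemma dotvBr (R : realType) (m : nat) (x y z : 'cV[R]_m) :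
  dotv x (y - z) = dotv x y - dotv x z.
Proof. by rewrite dotvDr dotvNr. Qed.

Lemma dotvZr (R : realType) (m : nat) (t : R) (x y : 'cV[R]_m) :
  dotv x (t *: y) = t * dotv x y.
Proof. by rewrite /dotv -scalemxAr mxE. Qed.

Lemma dotvDl (R : realType) (m : nat) (x y z : 'cV[R]_m) :
  dotv (x + y) z = dotv x z + dotv y z.
Proof. by rewrite !(dotvC _ z) dotvDr. Qed.

Lemma dotvNl (R : realType) (m : nat) (x y : 'cV[R]_m) :
  dotv (- x) y = - dotv x y.
Proof. by rewrite !(dotvC _ y) dotvNr. Qed.

Lemma dotv0r (R : realType) (m : nat) (x : 'cV[R]_m) : dotv x 0 = 0.
Proof. by rewrite /dotv mulmx0 mxE. Qed.

Lemma dotv_trmx (R : realType) (p m : nat) (M : 'M[R]_(p, m)) y x :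
  dotv (M^T *m y) x = dotv y (M *m x).
Proof. by rewrite /dotv trmx_mul trmxK mulmxA. Qed.

Lemma dotv_ler (R : realType) (m : nat) (y u v : 'cV[R]_m) :
  lev 0 y -> lev u v -> dotv y u <= dotv y v.
Proof.
move=> y0 uv; rewrite !dotvE ler_sum// => i _; rewrite ler_wpM2l//.
by have := y0 i; rewrite mxE.
Qed.

(** Homogenization: the inequality M x <= h becomes M x <= t h with t >= 0.
    At t = 0 the homogeneous implication is the statement that c is nonpositive
    on recession directions, which is where nonemptiness enters. *)
Lemma affine_farkas (R : realType) (p m : nat) (M : 'M[R]_(p, m))
    (h : 'cV[R]_p) (c : 'cV[R]_m) (v : R) :
  closed_polytope M h !=set0 ->
  (forall x, closed_polytope M h x -> dotv c x <= v) ->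
  exists y : 'cV[R]_p, [/\ lev 0 y, M^T *m y = c & dotv y h <= v].
Proof.
move=> [x0 Mx0] Hc.
pose a (j : 'I_p.+1) (z : 'cV[R]_m * R^o) : R :=
  if unlift ord0 j is Some k then (M *m z.1) k 0 - h k 0 * z.2 else - z.2.
pose b (z : 'cV[R]_m * R^o) : R := dotv c z.1 - v * z.2.
have [||z az|y y0 cE] := @farkas R _ _ a b.
- move=> j s z w; rewrite /a; case: unliftP => [k _|_] /=.
    by rewrite mulmxDr -scalemxAr !mxE /GRing.scale/=; ring.
  by rewrite /GRing.scale/=; ring.
- by move=> s z w; rewrite /b/= dotvDr dotvZr /GRing.scale/=; ring.
- have z2 : 0 <= z.2 by have := az ord0; rewrite /a unlift_none oppr_le0.
  have Mz k : (M *m z.1) k 0 <= h k 0 * z.2.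
    by have := az (lift ord0 k); rewrite /a liftK subr_le0.
  rewrite /b subr_le0; move: z2; rewrite le_eqVlt.
  move=> /predU1P[z2|z2]; last first.
    rewrite mulrC -ler_pdivrMl// -dotvZr; apply: Hc => k.
    by rewrite -scalemxAr mxE ler_pdivrMl// mulrC.
  rewrite -z2 mulr0 leNgt; apply/negP => cz.
  (* z.1 is a recession direction; going s times along it from x0, the form c
     takes the value v + 1. *)
  pose s := (v - dotv c x0 + 1) / dotv c z.1.
  have s0 : 0 <= s by rewrite divr_ge0 ?(ltW cz)// addr_ge0// subr_ge0 Hc.
  have : dotv c (x0 + s *: z.1) <= v.
    apply: Hc => k; rewrite mulmxDr -scalemxAr mxE -[leRHS]addr0 lerD//.
    by rewrite mxE mulr_ge0_le0// (le_trans (Mz k))// -z2 mulr0.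
  by rewrite dotvDr dotvZr divfK ?gt_eqF//; lra.
exists (\col_k y (lift ord0 k)); split.
- by move=> k; rewrite !mxE.
- apply/colP => i; have := cE (delta_mx i 0, 0); rewrite /b /a/= mulr0 subr0.
  rewrite big_ord_recl unlift_none oppr0 mulr0 add0r dotvE.
  rewrite (bigD1 i)//= mxE !eqxx mulr1 big1 ?addr0 => [->|j ji]; last first.
    by rewrite mxE (negbTE ji) mulr0.
  rewrite mxE; apply: eq_bigr => k _; rewrite liftK mulr0 subr0 !mxE mulrC.
  by rewrite (bigD1 i)//= mxE !eqxx mulr1 big1 ?addr0// => j ji;
    rewrite mxE (negbTE ji) mulr0.
- have := cE (0, 1); rewrite /b /a/= dotv0r mulr1 sub0r.
  rewrite big_ord_recl unlift_none mulrN1 => /eqP; rewrite eqr_oppLR => /eqP ->.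
  rewrite opprD opprK -sumrN dotvE -[leLHS]add0r lerD// ler_sum// => k _.
  by rewrite liftK mulmx0 !mxE mulr1 sub0r mulrN opprK.
Qed.

(** * Sublinear functions and the Mazur-Orlicz theorem *)

Record sublinear (R : realType) (V : lmodType R) (p : V -> R) : Prop :=
  Sublinear {
    sublinearD : forall x y, p (x + y) <= p x + p y;
    sublinearZ : forall t x, 0 <= t -> p (t *: x) = t * p x }.

(** A convex cone of pairs (w, c), thought of as a family of constraints asking
    of a linear form z that c <= z w. *)
Record convex_cone (R : realType) (V : lmodType R) (K : set (V * R)) : Prop :=
  ConvexCone {
    convex_cone0 : K (0, 0);
    convex_coneD : forall u v, K u -> K v -> K (u.1 + v.1, u.2 + v.2);
    convex_coneZ : forall t u, 0 <= t -> K u -> K (t *: u.1, t * u.2) }.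

Lemma sublinear0 (R : realType) (V : lmodType R) (p : V -> R) :
  sublinear p -> p 0 = 0.
Proof. by move=> /sublinearZ/(_ 0 0 (lexx 0)); rewrite scaler0 mul0r. Qed.

(** Lowering p to the infimum of p (x + w) - c over the constraints (w, c)
    makes every constraint hold for all linear forms below the new function.
    The infimum is finite because p (x + w) - c >= p w - p (- x) - c
    >= - p (- x). *)
Lemma sublinear_tilt (R : realType) (V : lmodType R) (p : V -> R)
    (K : set (V * R)) :
  sublinear p -> convex_cone K -> (forall u, K u -> u.2 <= p u.1) ->
  exists q : V -> R, [/\ sublinear q, forall x, q x <= p x &
    forall u, K u -> q (- u.1) <= - u.2].
Proof.
move=> sp cK Kp.
pose E x := [set p (x + u.1) - u.2 | u in K].
pose q x := inf (E x).
have lbE x : lbound (E x) (- p (- x)).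
  move=> _ [u Ku <-]; have := sublinearD sp (- x) (x + u.1).
  by rewrite addKr; have := Kp u Ku; lra.
have hE x : has_inf (E x).
  split; last by exists (- p (- x)).
  by exists (p (x + 0) - 0), (0, 0) => //; exact: convex_cone0.
have qle x u : K u -> q x <= p (x + u.1) - u.2.
  by move=> Ku; apply: ge_inf; [exact: (hE x).2|exists u].
have leqv x y : (forall u, K u -> y <= p (x + u.1) - u.2) -> y <= q x.
  move=> xy; apply: lb_le_inf; first exact: (hE x).1.
  by move=> _ [u Ku <-]; exact: xy.
have qp x : q x <= p x.
  by have := qle x _ (convex_cone0 cK); rewrite /= addr0 subr0.
have q0 : 0 <= q 0 by apply: (leqv _) => u Ku; rewrite add0r subr_ge0 Kp.
exists q; split => //; last first.
  by move=> u Ku; have := qle (- u.1) u Ku; rewrite addNr (sublinear0 sp) sub0r.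
have qD x y : q (x + y) <= q x + q y.
  rewrite -lerBlDr; apply: (leqv _) => u Ku; rewrite lerBlDr -lerBlDl.
  apply: (leqv y) => v Kv; rewrite lerBlDl.
  apply: le_trans (qle _ _ (convex_coneD cK Ku Kv)) _ => /=.
  rewrite addrACA; have := sublinearD sp (x + u.1) (y + v.1); lra.
have qZ t x : 0 < t -> t * q x <= q (t *: x).
  move=> t0; apply: (leqv _) => u Ku; rewrite mulrC -ler_pdivlMr//.
  have ti : 0 <= t^-1 by rewrite invr_ge0 ltW.
  apply: le_trans (qle _ _ (convex_coneZ cK ti Ku)) _ => /=.
  have -> : x + t^-1 *: u.1 = t^-1 *: (t *: x + u.1).
    by rewrite scalerDr scalerK ?lt0r_neq0.
  by rewrite (sublinearZ sp)// mulrBl mulrC [t^-1 * u.2]mulrC.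
split=> // t x; rewrite le_eqVlt => /predU1P[<-|t0].
  by rewrite scale0r mul0r; apply/eqP; rewrite eq_le q0 -(sublinear0 sp) qp.
apply/eqP; rewrite eq_le qZ// andbT.
rewrite -[leLHS](mulVKf (lt0r_neq0 t0)) ler_pM2l//.
apply: le_trans (qZ t^-1 _ _) _; first by rewrite invr_gt0.
by rewrite scalerK// lt0r_neq0.
Qed.

(** The constraints (t e, t p e), t >= 0, force every linear form below p to
    agree with p at e.  Imposing them for one vector after another makes p odd
    on all of them, and lowering p further preserves oddness. *)
Lemma sublinear_odd_on (R : realType) (V : lmodType R) (p : V -> R)
    (s : seq V) :
  sublinear p -> exists q : V -> R, [/\ sublinear q, forall x, q x <= p x &
    {in s, forall e, q (- e) <= - q e}].
Proof.
move=> sp; elim: s => [|e s [q [sq qp qs]]]; first by exists p; split.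
pose K : set (V * R) := [set u | exists2 t, 0 <= t & u = (t *: e, t * q e)].
have cK : convex_cone K.
  split.
  - by exists 0 => //; rewrite scale0r mul0r.
  - move=> _ _ [t t0 ->] [t' t'0 ->]; exists (t + t'); first exact: addr_ge0.
    by rewrite scalerDl mulrDl.
  - move=> t _ t0 [t' t'0 ->]; exists (t * t'); first exact: mulr_ge0.
    by rewrite scalerA mulrA.
have [|q' [sq' q'q q'K]] := sublinear_tilt sq cK.
  by move=> _ [t t0 ->]; rewrite /= (sublinearZ sq).
exists q'; split=> // [x|x]; first exact: le_trans (qp x).
have opp y : q (- y) <= - q y -> q' (- y) <= - q' y.
  by move=> qy; rewrite (le_trans (q'q _))// (le_trans qy)// lerN2.
rewrite inE => /predU1P[->|/qs/opp//].
have Ke : K (e, q e) by exists 1; rewrite // scale1r mul1r.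
by rewrite (le_trans (q'K _ Ke))// lerN2.
Qed.

Lemma cV_sum_delta (R : realType) (m : nat) (x : 'cV[R]_m) :
  x = \sum_i x i 0 *: delta_mx i 0.
Proof.
rewrite [LHS]matrix_sum_delta; apply: eq_bigr => i _.
by rewrite big_ord1.
Qed.

Lemma sublinear_sum (R : realType) (V : lmodType R) (p : V -> R) (I : finType)
    (F : I -> V) :
  sublinear p -> p (\sum_i F i) <= \sum_i p (F i).
Proof.
move=> sp; elim/big_ind2 : _ => //; first by rewrite (sublinear0 sp).
by move=> x y z w px pz; rewrite (le_trans (sublinearD sp _ _))// lerD.
Qed.

(** After the constraints of K, those of the standard basis are imposed; a
    sublinear function that is odd on a basis is linear. *)
Lemma mazur_orlicz (R : realType) (m : nat) (p : 'cV[R]_m -> R)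
    (K : set ('cV[R]_m * R)) :
  sublinear p -> convex_cone K -> (forall u, K u -> u.2 <= p u.1) ->
  exists z : 'cV[R]_m, (forall x, dotv z x <= p x) /\
    (forall u, K u -> u.2 <= dotv z u.1).
Proof.
move=> sp cK Kp; have [p' [sp' p'p p'K]] := sublinear_tilt sp cK Kp.
have [q [sq qp' qodd]] :=
  sublinear_odd_on [seq delta_mx i 0 | i : 'I_m] sp'.
pose z : 'cV[R]_m := \col_i q (delta_mx i 0).
have qz x : q x <= dotv z x.
  rewrite [in leLHS](cV_sum_delta x) (le_trans (sublinear_sum _ sq))// dotvE.
  apply: ler_sum => i _; rewrite mxE mulrC; have [xi|xi] := leP 0 (x i 0).
    by rewrite (sublinearZ sq).
  rewrite -[X in _ *: X]opprK scalerN -scaleNr.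
  rewrite (sublinearZ sq) ?oppr_ge0 ?(ltW xi)//.
  rewrite mulNr -mulrN ler_nM2l// lerNr qodd//.
  by apply/mapP; exists i => //; rewrite mem_enum.
have zq x : dotv z x <= q x.
  have := qz (- x); rewrite dotvNr; have := sublinearD sq x (- x).
  by rewrite subrr (sublinear0 sq); lra.
exists z; split=> [x|u Ku].
  by rewrite (le_trans (zq x))// (le_trans (qp' x)).
rewrite -lerN2 -dotvNr (le_trans (zq _))// (le_trans (qp' _))//.
exact: p'K.
Qed.

(** * Dual norm and multipliers *)

Lemma normv0 (R : realType) (m : nat) (nrm : 'cV[R]_m -> R) :
  is_norm nrm -> nrm 0 = 0.
Proof. by move=> [_ nZ _]; rewrite -(scale0r 0) nZ normr0 mul0r. Qed.

Lemma normvN (R : realType) (m : nat) (nrm : 'cV[R]_m -> R) x :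
  is_norm nrm -> nrm (- x) = nrm x.
Proof. by move=> [_ nZ _]; rewrite -scaleN1r nZ normrN normr1 mul1r. Qed.

Lemma normv_ge0 (R : realType) (m : nat) (nrm : 'cV[R]_m -> R) x :
  is_norm nrm -> 0 <= nrm x.
Proof.
move=> hn; have := is_norm_triangle hn x (- x).
by rewrite subrr (normv0 hn) (normvN _ hn); lra.
Qed.

Lemma normvB (R : realType) (m : nat) (nrm : 'cV[R]_m -> R) x y :
  is_norm nrm -> nrm (x - y) = nrm (y - x).
Proof. by move=> hn; rewrite -(normvN _ hn) opprB. Qed.

Lemma sublinear_norm (R : realType) (m : nat) (nrm : 'cV[R]_m -> R)
    (lambda : R) :
  is_norm nrm -> 0 <= lambda -> sublinear (fun x => lambda * nrm x).
Proof.
move=> hn l0; split=> [x y|t x t0].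
  by rewrite -mulrDr ler_wpM2l// is_norm_triangle.
by rewrite (is_norm_scale hn) ger0_norm// mulrCA.
Qed.

Lemma dual_norm_ge0 (R : realType) (m : nat) (nrm : 'cV[R]_m -> R) z :
  is_norm nrm -> (0 <= dual_norm nrm z)%E.
Proof.
move=> hn; apply: ereal_sup_ubound; exists 0; last by rewrite dotv0r.
by rewrite /= (normv0 hn).
Qed.

Lemma le_dual_norm (R : realType) (m : nat) (nrm : 'cV[R]_m -> R) z
    (lambda : R) x :
  is_norm nrm -> (dual_norm nrm z <= lambda%:E)%E ->
  dotv z x <= lambda * nrm x.
Proof.
move=> hn zl; have [/(is_norm_definite hn) ->|nx] := eqVneq (nrm x) 0.
  by rewrite dotv0r (normv0 hn) mulr0.
have {nx}nx : 0 < nrm x by rewrite lt_neqAle eq_sym nx normv_ge0.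
have : dotv z ((nrm x)^-1 *: x) <= lambda.
  rewrite -lee_fin (le_trans _ zl)//; apply: ereal_sup_ubound.
  exists ((nrm x)^-1 *: x) => //=.
  by rewrite (is_norm_scale hn) gtr0_norm ?invr_gt0// mulVf ?gt_eqF.
by rewrite dotvZr mulrC ler_pdivrMr.
Qed.

(** The sign condition matters when m = 0: there all forms vanish, while the
    dual norm is 0. *)
Lemma dual_norm_le (R : realType) (m : nat) (nrm : 'cV[R]_m -> R) z
    (lambda : R) :
  0 <= lambda -> (forall x, dotv z x <= lambda * nrm x) ->
  (dual_norm nrm z <= lambda%:E)%E.
Proof.
move=> l0 zl; apply: ge_ereal_sup => _ [x /= x1 <-]; rewrite lee_fin.
by rewrite (le_trans (zl x))// ler_piMr.
Qed.

Lemma dual_normN (R : realType) (m : nat) (nrm : 'cV[R]_m -> R) z :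
  is_norm nrm -> dual_norm nrm (- z) = dual_norm nrm z.
Proof.
move=> hn; congr ereal_sup; apply/seteqP.
by split=> _ [x /= x1 <-]; exists (- x);
  rewrite /= ?(normvN _ hn)// dotvNr ?dotvNl ?opprK.
Qed.

Lemma polytope_convex (R : realType) (p m : nat) (M : 'M[R]_(p, m)) h x y s t :
  closed_polytope M h x -> closed_polytope M h y -> 0 <= s -> 0 <= t ->
  s + t = 1 -> closed_polytope M h (s *: x + t *: y).
Proof.
move=> Mx My s0 t0 st k; rewrite mulmxDr -!scalemxAr mxE [X in X + _]mxE.
rewrite [X in _ + X]mxE -[leRHS]mul1r -st mulrDl.
by apply: lerD; apply: ler_wpM2l.
Qed.

(** The constraints asking that a linear form be at least c on P - x0. *)
Lemma convex_cone_over (R : realType) (V : lmodType R) (P : set V) (x0 : V)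
    (c : R) :
  P !=set0 ->
  (forall x y s t, P x -> P y -> 0 <= s -> 0 <= t -> s + t = 1 ->
    P (s *: x + t *: y)) ->
  convex_cone [set u : V * R | exists t x, [/\ 0 <= t, P x &
    u = (t *: (x - x0), t * c)]].
Proof.
move=> [w Pw] cP; split.
- by exists 0, w; split=> //; rewrite scale0r mul0r.
- move=> _ _ [s [x [s0 Px ->]]] [t [y [t0 Py ->]]] /=.
  have [st|st] := eqVneq (s + t) 0.
    have [-> ->] : s = 0 /\ t = 0 by split; lra.
    by exists 0, w; split=> //; rewrite !scale0r !mul0r !addr0.
  exists (s + t), ((s / (s + t)) *: x + (t / (s + t)) *: y); split.
  + exact: addr_ge0.
  + by apply: cP; rewrite ?divr_ge0 ?addr_ge0// -mulrDl divff.
  + rewrite mulrDl; congr (_, _); rewrite !scalerBr scalerDr !scalerA.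
    by rewrite ![_ * (_ / _)]mulrC !divfK// scalerDl opprD addrACA.
- move=> t _ t0 [s [x [s0 Px ->]]]; exists (t * s), x; split=> //.
    exact: mulr_ge0.
  by rewrite scalerA mulrA.
Qed.

(** A linear form z separates: c <= z (x - x0) on the polytope while
    z <= lambda * nrm.  The weights y then express - z as M^T y. *)
Lemma polytope_distance_certificate (R : realType) (p m : nat)
    (nrm : 'cV[R]_m -> R) (M : 'M[R]_(p, m)) (h : 'cV[R]_p) (x0 : 'cV[R]_m)
    (lambda c : R) :
  is_norm nrm -> 0 <= lambda -> closed_polytope M h !=set0 ->
  (forall x, closed_polytope M h x -> c <= lambda * nrm (x - x0)) ->
  exists y : 'cV[R]_p, [/\ lev 0 y, c + dotv y (h - M *m x0) <= 0 &
    (dual_norm nrm (M^T *m y) <= lambda%:E)%E].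
Proof.
move=> hn l0 P0 Pc.
have sp := sublinear_norm hn l0.
have cK := convex_cone_over x0 c P0 (@polytope_convex _ _ _ M h).
have [|z [zp zK]] := mazur_orlicz sp cK.
  by move=> u [t [x [t0 Px ->]]]; rewrite /= (sublinearZ sp)// ler_wpM2l// Pc.
have [|y [y0 My yh]] := @affine_farkas _ _ _ M h (- z) (- c - dotv z x0) P0.
  move=> x Px; have /zK : [set u | exists t x, [/\ 0 <= t, closed_polytope M h x &
      u = (t *: (x - x0), t * c)]] (x - x0, c).
    by exists 1, x; split=> //; rewrite scale1r mul1r.
  by rewrite dotvNl/= dotvBr; lra.
exists y; split=> //.
  by rewrite dotvBr -dotv_trmx My dotvNl; lra.
apply: dual_norm_le => // x.
by rewrite My dotvNl -dotvNr (le_trans (zp _))// (normvN _ hn).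
Qed.

Lemma closed_polytope_col (R : realType) (p q m : nat) (M : 'M[R]_(p, m))
    (C : 'M[R]_(q, m)) h d :
  closed_polytope (col_mx M C) (col_mx h d) =
  closed_polytope M h `&` closed_polytope C d.
Proof.
rewrite eqEsubset /closed_polytope; split=> x; rewrite /= mul_col_mx.
  move=> H; split=> k.
    by have := H (lshift q k); rewrite !col_mxEu.
  by have := H (rshift p k); rewrite !col_mxEd.
by move=> [Mx Cx] k; rewrite -(splitK k); case: (fintype.split k) => j /=;
  rewrite ?col_mxEu ?col_mxEd.
Qed.

Lemma certificate_complete (R : realType) (p q m : nat)
    (nrm : 'cV[R]_m -> R) (M : 'M[R]_(p, m)) h (C : 'M[R]_(q, m)) d
    (x0 : 'cV[R]_m) (lambda s : R) :
  is_norm nrm -> 0 <= lambda ->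
  closed_polytope M h `&` closed_polytope C d !=set0 ->
  (forall x, (closed_polytope M h `&` closed_polytope C d) x ->
    1 <= s + lambda * nrm (x - x0)) ->
  exists theta gamma, [/\ lev 0 theta, lev 0 gamma,
    1 + dotv theta (h - M *m x0) + dotv gamma (d - C *m x0) <= s &
    (dual_norm nrm (M^T *m theta + C^T *m gamma) <= lambda%:E)%E].
Proof.
move=> hn l0; rewrite -closed_polytope_col => P0 Ps.
have [|y [y0 ys yl]] := polytope_distance_certificate
    (x0 := x0) (c := 1 - s) hn l0 P0.
  by move=> x /Ps; lra.
exists (usubmx y), (dsubmx y).
move: y0 ys yl; rewrite -[y]vsubmxK col_mxKu col_mxKd.
move: (usubmx y) (dsubmx y) => {y}theta gamma y0 ys yl; split.
- by move=> k; have := y0 (lshift q k); rewrite col_mxEu !mxE.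
- by move=> k; have := y0 (rshift p k); rewrite col_mxEd !mxE.
- move: ys; rewrite mul_col_mx opp_col_mx add_col_mx /dotv.
  by rewrite tr_col_mx mul_row_col mxE; lra.
- by move: yl; rewrite tr_col_mx mul_row_col.
Qed.

Lemma certificate_sound (R : realType) (p q m : nat)
    (nrm : 'cV[R]_m -> R) (M : 'M[R]_(p, m)) h (C : 'M[R]_(q, m)) d
    (x0 : 'cV[R]_m) (lambda s : R) theta gamma :
  is_norm nrm -> lev 0 theta -> lev 0 gamma ->
  1 + dotv theta (h - M *m x0) + dotv gamma (d - C *m x0) <= s ->
  (dual_norm nrm (M^T *m theta + C^T *m gamma) <= lambda%:E)%E ->
  forall x, (closed_polytope M h `&` closed_polytope C d) x ->
    1 <= s + lambda * nrm (x - x0).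
Proof.
move=> hn t0 g0 ys yl x [Mx Cx].
have := dotv_ler t0 Mx; have := dotv_ler g0 Cx.
move: ys; rewrite !dotvBr.
have := le_dual_norm (x0 - x) hn yl; rewrite (normvB x0 x hn).
rewrite dotvDl !dotv_trmx !mulmxBr !dotvBr; lra.
Qed.

(** * Topology of an arbitrary norm *)

Lemma lipschitz_continuous (R : realType) (V W : normedModType R) (f : V -> W)
    (k : R) :
  (forall x y, `|f x - f y| <= k * `|x - y|) -> continuous f.
Proof.
move=> fk x; apply/cvgrPdist_le => e e0.
have k0 : 0 < `|k| + 1 by rewrite ltr_wpDl.
near=> t.
have xt : `|x - t| <= e / (`|k| + 1).
  by near: t; apply: cvgr_dist_le; [exact: cvg_id|rewrite divr_gt0].
apply: le_trans (fk _ _) _; apply: (@le_trans _ _ ((`|k| + 1) * `|x - t|)).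
  by rewrite ler_wpM2r// (le_trans (ler_norm k))// lerDl.
by rewrite mulrC -ler_pdivlMr.
Unshelve. all: by end_near. Qed.

Lemma mx_norm_ge_entry (R : realType) (m n : nat) (x : 'M[R]_(m, n)) i j :
  `|x i j| <= `|x|.
Proof.
rewrite [leRHS]/Num.norm/= mx_normrE.
by apply/bigmax_geP; right; exists (i, j).
Qed.

Lemma mx_norm_trmx_le (R : realType) (m n : nat) (x : 'M[R]_(m, n)) :
  `|x^T| <= `|x|.
Proof.
rewrite [leLHS]/Num.norm/= mx_normrE; apply/bigmax_leP; split=> //= ij _.
by rewrite mxE mx_norm_ge_entry.
Qed.

Lemma trmx_continuous (R : realType) (m n : nat) :
  continuous (@trmx R m n).
Proof.
apply: (@lipschitz_continuous _ _ _ _ 1) => x y.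
by rewrite mul1r -linearB mx_norm_trmx_le.
Qed.

(** Transported along transposition from the corresponding fact on row
    vectors. *)
Lemma cV_bounded_closed_compact (R : realType) (m : nat) (A : set 'cV[R]_m)
    (r : R) :
  (forall x, A x -> `|x| <= r) -> closed A -> compact A.
Proof.
move=> Ar cA; pose B := @trmx R 1 m @^-1` A.
have <- : @trmx R 1 m @` B = A.
  rewrite eqEsubset; split=> [_ [x Bx <-]//|x Ax].
  by exists x^T; rewrite /B/= trmxK.
apply: continuous_compact; first exact/continuous_subspaceT/trmx_continuous.
apply: bounded_closed_compact; last first.
  exact: (continuous_closedP _).1 (@trmx_continuous _ _ _) _ cA.
exists r; split; first exact: num_real.
move=> s rs x /Ar xr /=; rewrite -[x]trmxK (le_trans (mx_norm_trmx_le _))//.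
by rewrite (le_trans xr)// ltW.
Qed.

Lemma dotv_continuous (R : realType) (m : nat) (z : 'cV[R]_m) :
  continuous (dotv z : 'cV[R]_m -> R^o).
Proof.
apply: (@lipschitz_continuous _ _ _ _ (\sum_i `|z i 0|)) => x y.
rewrite -dotvBr dotvE mulr_suml (le_trans (ler_norm_sum _ _ _))//.
by apply: ler_sum => i _; rewrite normrM ler_wpM2l// mx_norm_ge_entry.
Qed.

(** By the triangle inequality on the standard basis, any norm is Lipschitz
    for the sup norm. *)
Lemma normv_continuous (R : realType) (m : nat) (nrm : 'cV[R]_m -> R) :
  is_norm nrm -> continuous (nrm : 'cV[R]_m -> R^o).
Proof.
move=> hn.
apply: (@lipschitz_continuous _ _ _ _ (\sum_i nrm (delta_mx i 0))) => x y.
have nle u : nrm u <= (\sum_i nrm (delta_mx i 0)) * `|u|.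
  have sn : sublinear nrm by have := sublinear_norm hn ler01; congr sublinear;
    apply/funext => v; rewrite mul1r.
  rewrite [in leLHS](cV_sum_delta u) (le_trans (sublinear_sum _ sn))//.
  rewrite mulr_suml; apply: ler_sum => i _; rewrite (is_norm_scale hn) mulrC.
  by rewrite ler_wpM2l ?normv_ge0// mx_norm_ge_entry.
apply: le_trans (nle (x - y)); rewrite ler_norml; apply/andP; split.
  by have := is_norm_triangle hn (y - x) x; rewrite subrK (normvB _ _ hn); lra.
by have := is_norm_triangle hn (x - y) y; rewrite subrK; lra.
Qed.

(** The norm attains a positive minimum on the unit sphere of the sup norm.  The
    sphere is empty exactly when m = 0. *)
Lemma normv_coercive (R : realType) (m : nat) (nrm : 'cV[R]_m -> R) :
  is_norm nrm -> exists2 c : R, 0 < c & forall x, c * `|x| <= nrm x.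
Proof.
move=> hn; pose S : set 'cV[R]_m := [set x | `|x| = 1].
have [[w Sw]|S0] := pselect (S !=set0); last first.
  exists 1 => // x; rewrite mul1r; have [->|x0] := eqVneq x 0.
    by rewrite normr0 (normv0 hn).
  exfalso; apply: S0; exists (`|x|^-1 *: x).
  by rewrite /S/= normrZ normfV normr_id mulVf ?normr_eq0.
have cS : closed S.
  have := (continuous_closedP _).1 (@norm_continuous _ 'cV[R]_m) _
    (@closed_eq R (1 : R)).
  exact.
have [||c Sc cmin] := compact_EVT_min _ (@cV_bounded_closed_compact _ _ S 1 _ cS)
  (continuous_subspaceT (normv_continuous hn)).
- by exists w.
- by move=> x ->.
have c1 : `|c| = 1 by have := set_mem Sc.
exists (nrm c).
  rewrite lt_neqAle normv_ge0// andbT eq_sym.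
  apply/eqP => /(is_norm_definite hn) c0.
  by move: c1; rewrite c0 normr0 => /eqP; rewrite eq_sym oner_eq0.
move=> x; have [->|x0] := eqVneq x 0; first by rewrite normr0 mulr0 (normv0 hn).
have nx : 0 < `|x| by rewrite normr_gt0.
rewrite -ler_pdivlMr//.
have -> : nrm x / `|x| = nrm (`|x|^-1 *: x).
  by rewrite (is_norm_scale hn) normfV normr_id mulrC.
apply: cmin; apply/mem_set.
by rewrite /S/= normrZ normfV normr_id mulVf ?normr_eq0.
Qed.

Lemma nearest_point (R : realType) (m : nat) (nrm : 'cV[R]_m -> R)
    (S : set 'cV[R]_m) x0 :
  is_norm nrm -> closed S -> S !=set0 ->
  exists2 x, S x & forall y, S y -> nrm (x - x0) <= nrm (y - x0).
Proof.
move=> hn cS [w Sw]; have [c c0 nc] := normv_coercive hn.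
have cf : continuous ((fun x => nrm (x - x0)) : 'cV[R]_m -> R^o).
  move=> x.
  apply: (@continuous_comp 'cV[R]_m 'cV[R]_m R^o (fun x => x - x0) nrm).
    apply: (@lipschitz_continuous _ _ _ _ 1) => y z.
    by rewrite mul1r opprB addrA subrK.
  exact: normv_continuous.
pose A := S `&` [set x | nrm (x - x0) <= nrm (w - x0)].
have cA : closed A.
  apply: closedI => //; have := (continuous_closedP _).1 cf _
    (@closed_le R (nrm (w - x0))).
  exact.
have [||x Ax xmin] := compact_EVT_min _
    (@cV_bounded_closed_compact _ _ A (`|x0| + nrm (w - x0) / c) _ cA)
    (continuous_subspaceT cf).
- by exists w; split=> /=.
- move=> x [_ /= xw]; rewrite -[x in leLHS](subrK x0) addrC.
  rewrite (le_trans (ler_normD _ _))// lerD2l ler_pdivlMr// mulrC.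
  by rewrite (le_trans (nc _)).
have {}Ax := set_mem Ax; exists x => [|y Sy]; first by case: Ax.
have [yw|/ltW wy] := leP (nrm (y - x0)) (nrm (w - x0)).
  by apply: xmin; apply/mem_set; split.
by apply: le_trans wy; case: Ax.
Qed.

Lemma mulmx_entry (R : realType) (p m : nat) (M : 'M[R]_(p, m)) k x :
  (M *m x) k 0 = dotv (rowv M k) x.
Proof. by rewrite /dotv /rowv trmxK -row_mul [in RHS]mxE. Qed.

Lemma closed_halfspace (R : realType) (m : nat) (z : 'cV[R]_m) (b : R) :
  closed [set x : 'cV[R]_m | dotv z x <= b].
Proof.
exact: ((continuous_closedP _).1 (@dotv_continuous _ _ z) _ (@closed_le R b)).
Qed.

Lemma closed_closed_polytope (R : realType) (p m : nat) (M : 'M[R]_(p, m)) h :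
  closed (closed_polytope M h).
Proof.
have -> : closed_polytope M h =
    \bigcap_(k in setT) [set x | dotv (rowv M k) x <= h k 0].
  rewrite eqEsubset; split=> x Mx k; first by rewrite /= -mulmx_entry.
  by rewrite mulmx_entry; exact: Mx.
by apply: closed_bigI => k _; exact: closed_halfspace.
Qed.

Lemma setC_open_polytope (R : realType) (p m : nat) (M : 'M[R]_(p, m)) h :
  ~` open_polytope M h =
  \bigcup_(k in [set: 'I_p]) [set x | h k 0 <= dotv (rowv M k) x].
Proof.
rewrite eqEsubset; split=> x.
  by move=> /existsNP[k /negP]; rewrite -leNgt mulmx_entry => hk; exists k.
by move=> [k _ /=]; rewrite -mulmx_entry leNgt => /negP hk /(_ k).
Qed.

Lemma closed_setC_open_polytope (R : realType) (p m : nat) (M : 'M[R]_(p, m)) h :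
  closed (~` open_polytope M h).
Proof.
rewrite setC_open_polytope.
have -> : [set: 'I_p] = [set` index_enum 'I_p].
  by apply/seteqP; split=> k //= _; rewrite mem_index_enum.
rewrite bigcup_seq; apply: closed_bigsetU => k _.
exact: ((continuous_closedP _).1 (@dotv_continuous _ _ _) _ (@closed_ge R _)).
Qed.

(** * Lower integrals and finitely supported measures *)

(** The integral of a nonnegative function is a supremum over the simple
    functions below it, hence monotone without any measurability.  This avoids
    the measurability of z |-> nrm (z.1 - z.2) for the product sigma-algebra. *)
Lemma ge0_le_lower_integral d (T : measurableType d) (R : realType)
    (mu : {measure set T -> \bar R}) (D D' : set T) (f g : T -> \bar R) :
  (forall x, D x -> (0 <= f x)%E) -> (forall x, D' x -> (0 <= g x)%E) ->
  D `<=` D' -> (forall x, D x -> (f x <= g x)%E) ->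
  (\int[mu]_(x in D) f x <= \int[mu]_(x in D') g x)%E.
Proof.
move=> f0 g0 DD' fg; rewrite !ge0_integralE//.
apply: le_ereal_sup => _ [h hf <-]; exists h => // x.
apply: (le_trans (hf x)); rewrite /patch; case: ifPn => [/set_mem Dx|_].
  by rewrite mem_set ?fg//; exact: DD'.
by case: ifPn => // /set_mem; exact: g0.
Qed.

Lemma integral_sum_indic d (T : measurableType d) (R : realType)
    (mu : {measure set T -> \bar R}) (D : set T) (I : finType) (a : I -> R)
    (A : I -> set T) :
  measurable D -> (forall i, measurable (A i)) -> (forall i, 0 <= a i) ->
  (\int[mu]_(x in D) (\sum_i a i * \1_(A i) x)%:E =
   \sum_i (a i)%:E * mu (A i `&` D))%E.
Proof.
move=> mD mA a0; under eq_integral do rewrite -sumEFin.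
rewrite ge0_integral_sum//; last 2 first.
- by move=> i; apply/measurable_EFinP; apply: measurable_funM.
- by move=> i x _; rewrite lee_fin mulr_ge0.
apply: eq_bigr => i _; under eq_integral do rewrite EFinM.
rewrite ge0_integralZl_EFin//; last first.
  by apply/measurable_EFinP; exact: measurable_indic.
by rewrite integral_indic.
Qed.

Lemma measurable_sum_indic d (T : measurableType d) (R : realType)
    (D : set T) (I : finType) (a : I -> R) (A : I -> set T) :
  (forall i, measurable (A i)) ->
  measurable_fun D (fun x => (\sum_i a i * \1_(A i) x)%:E).
Proof.
move=> mA; apply/measurable_EFinP; apply: measurable_sum => i.
by apply: measurable_funM => //; exact: measurable_indic.
Qed.

(** Finite sums of measures are indexed by natural numbers; the enumeration of I
    turns a sum over I into one of them. *)
Lemma weighted_dirac_msum d (T : measurableType d) (R : realType)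
    (I : finType) (w : I -> R) (x : I -> T) (w0 : forall i, 0 <= w i) :
  exists m_ : nat -> {measure set T -> \bar R},
    (forall A, msum m_ #|I| A = \sum_i (w i)%:E * \d_(x i) A)%E /\
    forall j : 'I_#|I|,
      m_ j = mscale (NngNum (w0 (enum_val j))) (dirac (x (enum_val j))).
Proof.
pose m_ (k : nat) : {measure set T -> \bar R} :=
  if insub k is Some j
  then mscale (NngNum (w0 (enum_val (j : 'I_#|I|)))) (dirac (x (enum_val j)))
  else mzero.
exists m_; split=> [A|j]; last by rewrite /m_ valK.
rewrite /msum [RHS]big_enum_val; apply: eq_bigr => j _.
by rewrite /m_ valK.
Qed.

Lemma discrete_probability d (T : measurableType d) (R : realType)
    (I : finType) (w : I -> R) (x : I -> T) :
  (forall i, 0 <= w i) -> \sum_i w i = 1 ->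
  exists P : probability T R,
    forall A, (P A = \sum_i (w i)%:E * \d_(x i) A)%E.
Proof.
move=> w0 w1; have [m_ [mE _]] := weighted_dirac_msum x w0.
have mT : msum m_ #|I| setT = 1%E.
  rewrite mE; under eq_bigr do rewrite diracT mule1.
  by rewrite sumEFin w1.
pose P : probability T R := HB.pack_for (probability T R) (msum m_ #|I|)
  (Measure_isProbability.Build _ _ _ (msum m_ #|I|) mT).
by exists P.
Qed.

(** Only an upper bound, but for arbitrary f: a simple function h below f has
    integral \sum_i w i * h (x i). *)
Lemma integral_discrete_le d (T : measurableType d) (R : realType)
    (I : finType) (w : I -> R) (x : I -> T) (mu : {measure set T -> \bar R})
    (D : set T) (f : T -> R) :
  (forall i, 0 <= w i) ->
  (forall A, mu A = \sum_i (w i)%:E * \d_(x i) A)%E ->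
  (forall z, 0 <= f z) ->
  (\int[mu]_(z in D) (f z)%:E <= (\sum_i w i * f (x i))%:E)%E.
Proof.
move=> w0 muE f0; have [m_ [mE m_E]] := weighted_dirac_msum x w0.
have {}muE : (mu : set T -> \bar R) = msum m_ #|I|.
  by apply/funext => A; rewrite muE mE.
rewrite ge0_integralE; last by move=> z _; rewrite lee_fin.
apply: ge_ereal_sup => _ [h hf <-].
have {}hf z : h z <= f z.
  rewrite -lee_fin (le_trans (hf z))// /patch; case: ifPn => // _.
  by rewrite lee_fin.
rewrite muE -integralT_nnsfun integral_measure_sum_nnsfun//.
rewrite -sumEFin [leRHS]big_enum_val; apply: lee_sum => i _.
rewrite m_E ge0_integral_mscale//=; last 2 first.
- exact/measurable_EFinP.
- by move=> z _; rewrite lee_fin.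
rewrite integral_dirac//; last exact/measurable_EFinP.
by rewrite diracT mul1e -EFinM lee_fin ler_wpM2l.
Qed.

(** * Upper bound on the probability of an event *)

Lemma measurable_closed_cV (R : realType) (m : nat) (F : set (borel_cV R m)) :
  closed (F : set 'cV[R]_m) -> measurable F.
Proof.
move=> cF; rewrite -[F]setCK; apply: measurableC.
by apply: sub_sigma_algebra; exact: closed_openC.
Qed.

Lemma measurable_singleton_cV (R : realType) (m : nat) (x : borel_cV R m) :
  measurable [set x].
Proof.
apply: measurable_closed_cV; apply: accessible_closed_set1.
by apply: hausdorff_accessible; exact: norm_hausdorff.
Qed.

(** The points xihat_i may coincide.  Giving each index the inverse of the
    multiplicity of its point turns sums over indices into sums over points. *)
Lemma multiplicity_weights (R : numFieldType) (T : eqType) (N : nat)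
    (x : 'I_N -> T) :
  exists c : 'I_N -> R, [/\ forall i, 0 <= c i,
    forall j, \sum_i c i * (x j == x i)%:R = 1 &
    forall i, c i * \sum_j (x j == x i)%:R = 1].
Proof.
pose mult i : R := \sum_j (x j == x i)%:R.
have mult_gt0 i : 0 < mult i.
  by rewrite /mult (bigD1 i)//= eqxx ltr_pwDl// sumr_ge0.
exists (fun i => (mult i)^-1); split=> [i|j|i].
- by rewrite invr_ge0 ltW.
- rewrite -[RHS](mulVf (lt0r_neq0 (mult_gt0 j))) mulr_sumr.
  apply: eq_bigr => i _; rewrite [in RHS]eq_sym.
  by have [xij|] := eqVneq (x j) (x i); rewrite ?mulr0// /mult xij.
- by rewrite mulVf// lt0r_neq0.
Qed.

(** Under a coupling, almost every z has z.1 among the xihat_i and z.2 in Xi.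
    There the indicator of F at z.2 is at most A z + B z, where A z is the
    average of the s_i over the i with xihat_i = z.1, and B z is the average of
    the positive parts of 1 - s_i if z.2 is in F.  The integral of A is
    computed from the first marginal, and B lies below lambda times the cost. *)
Lemma coupling_bound (R : realType) (m N : nat) (nrm : 'cV[R]_m -> R)
    (Xi F : set (borel_cV R m)) (xihat : 'I_N -> borel_cV R m)
    (lambda : R) (s : 'I_N -> R) (Q : probability (borel_cV R m) R)
    (Pi : probability (borel_cV R m * borel_cV R m)%type R) :
  is_norm nrm -> measurable Xi -> measurable F -> (forall i, Xi (xihat i)) ->
  0 <= lambda -> (forall i, 0 <= s i) ->
  (forall i xi, (F `&` Xi) xi ->
    1 <= s i + lambda * nrm ((xi : 'cV[R]_m) - xihat i)) ->
  Q Xi = 1%E -> coupling (empirical R xihat) Q Pi ->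
  (Q F <= lambda%:E * \int[Pi]_(z in Xi `*` Xi)
             (nrm ((z.1 : 'cV[R]_m) - (z.2 : 'cV[R]_m))%R)%:E
          + (N%:R^-1 * \sum_i s i)%:E)%E.
Proof.
move=> hn mXi mF Xixi l0 s0 sF QXi cPi.
have [c [c0 cD cE]] := @multiplicity_weights R 'cV[R]_m N xihat.
pose S := \bigcup_(i in [set: 'I_N]) [set xihat i].
have mS : measurable S.
  by apply: fin_bigcup_measurable => // i _; exact: measurable_singleton_cV.
pose D := S `*` Xi.
have mD : measurable D by exact: measurableX.
pose E i := [set xihat i] `*` [set: borel_cV R m].
pose G i := [set xihat i] `*` F.
have mE i : measurable (E i).
  by apply: measurableX => //; exact: measurable_singleton_cV.
have mG i : measurable (G i).
  by apply: measurableX => //; exact: measurable_singleton_cV.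
pose a i := c i * s i.
pose b i := c i * Num.max 0 (1 - s i).
have a0 i : 0 <= a i by rewrite mulr_ge0.
have b0 i : 0 <= b i by rewrite mulr_ge0// le_max lexx.
have marg1 A : measurable A ->
    (Pi (A `*` setT) = N%:R^-1%:E * \sum_i \d_(xihat i) A)%E.
  by move=> /cPi[].
have marg2 A : measurable A -> (Pi (setT `*` A) = Q A)%E by move=> /cPi[].
have PiE i : ((a i)%:E * Pi (E i) = (N%:R^-1 * s i)%:E)%E.
  rewrite marg1; last exact: measurable_singleton_cV.
  rewrite -[X in (_ * (_ * X))%E](_ :
      (\sum_j (xihat j == xihat i :> 'cV[R]_m)%:R)%:E = _)%E.
    rewrite -!EFinM /a; congr (_%:E).
    have := cE i; set M := \sum_j _ => cM.
    by rewrite -[in RHS](mulr1 (s i)) -[X in s i * X]cM; ring.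
  rewrite -sumEFin; apply: eq_bigr => j _; rewrite diracE.
  congr ((_ : bool)%:R%:E).
  by apply/eqP/idP => [->|/set_mem//]; rewrite inE.
(* The complement of D is covered by two null cylinders. *)
have QF : (Q F <= Pi ((setT `*` F) `&` D))%E.
  rewrite -marg2//.
  have mSC : measurable (~` S `*` [set: borel_cV R m]).
    by apply: measurableX => //; exact: measurableC.
  have mXC : measurable ([set: borel_cV R m] `*` ~` Xi).
    by apply: measurableX => //; exact: measurableC.
  have mTF : measurable ([set: borel_cV R m] `*` F) by exact: measurableX.
  have PSC : Pi (~` S `*` setT) = 0%E.
    rewrite marg1; last exact: measurableC.
    rewrite big1 ?mule0// => i _.
    by rewrite diracE memNset//= => /(_ _); apply; exists i.
  have PXC : Pi (setT `*` ~` Xi) = 0%E.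
    rewrite marg2; last exact: measurableC.
    by rewrite probability_setC// QXi subee.
  apply: (@le_trans _ _ (Pi (((setT `*` F) `&` D) `|`
      ((~` S `*` setT) `|` (setT `*` ~` Xi))))).
    apply: le_measure; rewrite ?inE//.
      by apply: measurableU; [exact: measurableI|exact: measurableU].
    move=> z [_ Fz]; have [Sz|Sz] := pselect (S z.1); last by right; left.
    by have [Xz|Xz] := pselect (Xi z.2); [left|right; right].
  have mU : measurable (~` S `*` [set: borel_cV R m] `|`
      [set: borel_cV R m] `*` ~` Xi) by exact: measurableU.
  apply: le_trans (measureU2 _ _ mU) _; first exact: measurableI.
  rewrite -[leRHS]adde0 leeD//.
  apply: le_trans (measureU2 _ mSC mXC) _.
  by rewrite [X in (X + _)%E]PSC [X in (_ + X)%E]PXC adde0.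
apply: (le_trans QF); rewrite -integral_indic//; last exact: measurableX.
pose A z : R := \sum_i a i * \1_(E i) z.
pose B z : R := \sum_i b i * \1_(G i) z.
have A0 z : 0 <= A z by apply: sumr_ge0 => i _; rewrite mulr_ge0.
have B0 z : 0 <= B z by apply: sumr_ge0 => i _; rewrite mulr_ge0.
have mA : measurable_fun D (EFin \o A) by exact: measurable_sum_indic.
have mB : measurable_fun D (EFin \o B) by exact: measurable_sum_indic.
apply: (@le_trans _ _ (\int[Pi]_(z in D) ((A z)%:E + (B z)%:E))%E).
  apply: ge0_le_lower_integral => // z [[j _ /= zj] Xz].
    by rewrite adde_ge0// lee_fin.
  rewrite -EFinD lee_fin indicE.
  have [Fz|_] := boolP (z \in _); last by rewrite addr_ge0.
  rewrite /A /B -big_split/= -(cD j); apply: ler_sum => i _.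
  rewrite !indicE /a /b -!mulrA -mulrDr ler_wpM2l//.
  have [xji|] := eqVneq (xihat j : 'cV[R]_m) (xihat i); last first.
    by rewrite addr_ge0// mulr_ge0// le_max lexx.
  have Ei : z \in E i by apply/mem_set; split=> //=; exact: etrans zj xji.
  have Gi : z \in G i.
    by apply/mem_set; split; [exact: etrans zj xji|case: (set_mem Fz)].
  by rewrite Ei Gi !mulr1 -lerBlDl le_max lexx orbT.
rewrite ge0_integralD//; last 2 first.
- by move=> z _; rewrite lee_fin.
- by move=> z _; rewrite lee_fin.
rewrite addeC leeD//; last first.
  rewrite integral_sum_indic// mulr_sumr -sumEFin; apply: lee_sum => i _.
  rewrite -PiE lee_wpmul2l ?lee_fin// le_measure ?inE//.
  exact: measurableI.
have Bl z : D z -> B z <= lambda * nrm ((z.1 : 'cV[R]_m) - z.2).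
  move=> [[j _ /= zj] Xz].
  have nz : 0 <= lambda * nrm ((z.1 : 'cV[R]_m) - z.2).
    by rewrite mulr_ge0// normv_ge0.
  rewrite -[leRHS]mul1r -(cD j) mulr_suml; apply: ler_sum => i _.
  rewrite /b -!mulrA ler_wpM2l// indicE.
  have [Gz|] := boolP (z \in G i); last by rewrite mulr0 mulr_ge0.
  have [/= zi Fz] := set_mem Gz.
  rewrite -zj zi eqxx mulr1 mul1r ge_max -zi nz/=.
  by have := sF i z.2 (conj Fz Xz); rewrite -zi (normvB _ _ hn); lra.
have DX : D `<=` Xi `*` Xi by move=> z [[j _ /= ->] Xz]; split.
have n0 z : (0 <= (nrm ((z.1 : 'cV[R]_m) - z.2))%:E)%E.
  by rewrite lee_fin normv_ge0.
(* For lambda = 0 the bound on B says that B vanishes on D; otherwise B / lambda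
   is a simple function below the cost. *)
have [l0'|l0'] := eqVneq lambda 0.
  rewrite l0' mul0e -(integral0 Pi D); apply: ge0_le_lower_integral => // z Dz.
    by rewrite lee_fin.
  by rewrite lee_fin; have := Bl z Dz; rewrite l0' mul0r.
have lp : 0 < lambda by rewrite lt_neqAle eq_sym l0' l0.
rewrite muleC -lee_pdivrMr// muleC -ge0_integralZl_EFin//; last 2 first.
- by move=> z _; rewrite lee_fin.
- by rewrite invr_ge0.
apply: ge0_le_lower_integral => // z Dz.
  by rewrite -EFinM lee_fin mulr_ge0// invr_ge0.
by rewrite -EFinM lee_fin ler_pdivrMl// Bl.
Qed.

(** The infimum defining the distance may not be attained, so a coupling of cost
    at most eps + e / (lambda + 1) is used, which loses at most e. *)
Lemma weak_duality (R : realType) (m N : nat) (nrm : 'cV[R]_m -> R)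
    (Xi F : set (borel_cV R m)) (xihat : 'I_N -> borel_cV R m)
    (eps lambda : R) (s : 'I_N -> R) (Q : probability (borel_cV R m) R) :
  is_norm nrm -> measurable Xi -> measurable F -> (forall i, Xi (xihat i)) ->
  0 <= lambda -> (forall i, 0 <= s i) ->
  (forall i xi, (F `&` Xi) xi ->
    1 <= s i + lambda * nrm ((xi : 'cV[R]_m) - xihat i)) ->
  wasserstein_ball nrm Xi (empirical R xihat) eps Q ->
  (Q F <= (lambda * eps + N%:R^-1 * \sum_i s i)%:E)%E.
Proof.
move=> hn mXi mF Xixi l0 s0 sF [[QXi _] Qeps]; apply/lee_addgt0Pr => e e0.
have l1 : 0 < lambda + 1 by rewrite ltr_wpDl.
have : (wasserstein nrm Xi (empirical R xihat) Q <
        (eps + e / (lambda + 1))%:E)%E.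
  by rewrite (le_lt_trans Qeps)// lte_fin ltrDl divr_gt0.
move=> /ereal_inf_lt[_ [Pi cPi <-]] Pie.
apply: (le_trans (coupling_bound hn mXi mF Xixi l0 s0 sF QXi cPi)).
apply: (@le_trans _ _ (lambda%:E * (eps + e / (lambda + 1))%:E +
    (N%:R^-1 * \sum_i s i)%:E)%E).
  by rewrite leeD2r// lee_wpmul2l ?lee_fin// ltW.
rewrite -EFinM -!EFinD lee_fin mulrDr -!addrA lerD2l addrC lerD2l.
by rewrite mulrA ler_pdivrMr// mulrDr mulr1 mulrC lerDl ltW.
Qed.

(** * Worst-case distributions *)

(** Linear programming duality, with lambda the multiplier of the capacity and
    s_i that of alpha_i <= 1. *)
Lemma knapsack_duality (R : realType) (N : nat) (D : 'I_N -> R) (b v : R) :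
  0 <= b ->
  (forall alpha : 'I_N -> R, (forall i, 0 <= alpha i <= 1) ->
    \sum_i D i * alpha i <= b -> \sum_i alpha i <= v) ->
  exists (lambda : R) (s : 'I_N -> R), [/\ 0 <= lambda, forall i, 0 <= s i,
    forall i, 1 <= s i + lambda * D i & lambda * b + \sum_i s i <= v].
Proof.
move=> b0 Hv.
pose M : 'M[R]_(1 + (N + N), N) :=
  col_mx (\row_i D i) (col_mx 1%:M (- 1%:M)).
pose h : 'cV[R]_(1 + (N + N)) := col_mx b%:M (col_mx (const_mx 1) 0).
have feas x : closed_polytope M h x <->
    \sum_i D i * x i 0 <= b /\ forall i, 0 <= x i 0 <= 1.
  have DE : ((\row_i D i) *m x) 0 0 = \sum_i D i * x i 0.
    by rewrite mxE; apply: eq_bigr => i _; rewrite mxE.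
  rewrite !closed_polytope_col /closed_polytope /lev /=; split.
    move=> [Db [x1 x0]]; split=> [|i].
      by have := Db 0; rewrite DE mxE mulr1n.
    have := x1 i; have := x0 i.
    by rewrite mulNmx mul1mx !mxE oppr_le0 => -> ->.
  move=> [Db x01]; split=> [i|]; last split=> i.
  - by rewrite ord1 DE mxE mulr1n.
  - by rewrite mul1mx mxE; case/andP: (x01 i).
  - by rewrite mulNmx mul1mx !mxE oppr_le0; case/andP: (x01 i).
have [||y [y0 yM yh]] := @affine_farkas _ _ _ M h (const_mx 1) v.
- exists 0; apply/feas; split=> [|i]; last by rewrite mxE lexx ler01.
  by rewrite big1// => i _; rewrite mxE mulr0.
- move=> x /feas[Db x01]; rewrite dotvE.
  under eq_bigr do rewrite mxE mul1r.
  exact: (Hv (fun i => x i 0)).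
(* r is the multiplier of 0 <= alpha_i; being nonnegative, it is a slack. *)
pose l := usubmx y; pose s := usubmx (dsubmx y); pose r := dsubmx (dsubmx y).
have yE : y = col_mx l (col_mx s r) by rewrite !vsubmxK.
clearbody l s r.
have l0 : 0 <= l 0 0 by have := y0 (lshift _ 0); rewrite yE col_mxEu mxE.
have s0 i : 0 <= s i 0.
  by have := y0 (rshift _ (lshift _ i)); rewrite yE col_mxEd col_mxEu mxE.
have r0 i : 0 <= r i 0.
  by have := y0 (rshift _ (rshift _ i)); rewrite yE !col_mxEd mxE.
exists (l 0 0), (fun i => s i 0); split=> // [i|].
  have : (M^T *m y) i 0 = 1 by rewrite yM mxE.
  rewrite yE !tr_col_mx !mul_row_col linearN/= trmx1 mulNmx !mul1mx !mxE.
  rewrite big_ord1 !mxE -[ord0]/(0 : 'I_1); have := r0 i; lra.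
move: yh; rewrite yE /dotv !tr_col_mx !mul_row_col mulmx0 addr0 mxE.
rewrite [X in X + _]mxE [X in _ + X]mxE big_ord1 !mxE mulr1n.
by under eq_bigr do rewrite !mxE mulr1.
Qed.

(** The pair (i, true) carries the fraction alpha_i of the i-th atom, moved to
    zeta_i, and (i, false) the fraction left in place; the coupling records the
    origin of the mass. *)
Lemma transport_plan (R : realType) (m N : nat) (nrm : 'cV[R]_m -> R)
    (Xi F : set (borel_cV R m)) (xihat zeta : 'I_N -> borel_cV R m)
    (eps : R) (alpha : 'I_N -> R) :
  is_norm nrm -> (0 < N)%N -> (forall i, Xi (xihat i)) ->
  (forall i, (F `&` Xi) (zeta i)) -> (forall i, 0 <= alpha i <= 1) ->
  N%:R^-1 * \sum_i nrm ((zeta i : 'cV[R]_m) - xihat i) * alpha i <= eps ->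
  exists2 Q, wasserstein_ball nrm Xi (empirical R xihat) eps Q &
    ((N%:R^-1 * \sum_i alpha i)%:E <= Q F)%E.
Proof.
move=> hn N0 Xixi FXzeta a01 aeps.
pose w (j : 'I_N * bool) : R :=
  N%:R^-1 * (if j.2 then alpha j.1 else 1 - alpha j.1).
pose x (j : 'I_N * bool) : borel_cV R m :=
  if j.2 then zeta j.1 else xihat j.1.
have N_ge0 : 0 <= N%:R^-1 :> R by rewrite invr_ge0.
have w0 j : 0 <= w j.
  rewrite mulr_ge0//; case/andP: (a01 j.1) => a0 a1.
  by case: ifP => // _; rewrite subr_ge0.
have sumE (f : 'I_N * bool -> R) :
    \sum_j f j = \sum_i (f (i, true) + f (i, false)).
  transitivity (\sum_j f (j.1, j.2)); first by apply: eq_bigr => -[].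
  rewrite -(pair_bigA _ (fun i k => f (i, k)))/=.
  by apply: eq_bigr => i _; rewrite big_bool.
have w1 : \sum_j w j = 1.
  rewrite sumE /w/=; under eq_bigr do rewrite -mulrDr addrC subrK mulr1.
  by rewrite sumr_const card_ord -[LHS]mulr_natr mulVf// pnatr_eq0 -lt0n.
have wE i : w (i, true) + w (i, false) = N%:R^-1.
  by rewrite /w/= -mulrDr addrC subrK mulr1.
have [Q QE] := discrete_probability x w0 w1.
have [Pi PiE] := discrete_probability (fun j => (xihat j.1, x j)) w0 w1.
exists Q; [split; [split|]|].
- rewrite QE; under eq_bigr.
    move=> j _; rewrite diracE mem_set ?mule1; last first.
      by rewrite /x; case: ifP => // _; case: (FXzeta j.1).
    over.
  by rewrite sumEFin w1.
- apply: le_lt_trans (integral_discrete_le _ w0 QE _) _.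
    by move=> z; exact: normv_ge0.
  exact: ltry.
- apply: (@le_trans _ _ (\int[Pi]_(z in Xi `*` Xi)
      (nrm ((z.1 : 'cV[R]_m) - (z.2 : 'cV[R]_m))%R)%:E)%E).
    apply: ereal_inf_lbound; exists Pi => // A mA; split.
      rewrite PiE; transitivity ((N%:R^-1 : R)%:E * \sum_i \d_(xihat i) A)%E => //.
      under eq_bigr do rewrite diracE -EFinM.
      under [in RHS]eq_bigr do rewrite diracE.
      rewrite !sumEFin sumE -EFinM mulr_sumr; congr (_%:E).
      apply: eq_bigr => i _; rewrite -mulrDl wE; congr (_ * (_ : bool)%:R).
      by apply/idP/idP => [/set_mem[Ax _]|/set_mem Ax]; apply/mem_set.
    rewrite PiE [RHS]QE; apply: eq_bigr => j _; rewrite !diracE.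
    congr (_ * (_ : bool)%:R%:E)%E.
    by apply/idP/idP => [/set_mem[_ Ax]|/set_mem Ax]; apply/mem_set.
  apply: le_trans (integral_discrete_le _ w0 PiE _) _.
    by move=> z; exact: normv_ge0.
  rewrite lee_fin (le_trans _ aeps)// sumE mulr_sumr; apply: ler_sum => i _.
  rewrite /w /x/= subrr (normv0 hn) mulr0 addr0 (normvB _ _ hn).
  by rewrite -mulrA [alpha i * _]mulrC.
- rewrite QE; under [leRHS]eq_bigr do rewrite diracE -EFinM.
  rewrite sumEFin lee_fin sumE mulr_sumr; apply: ler_sum => i _.
  rewrite /x/= [_ \in _]mem_set; last by case: (FXzeta i).
  by rewrite {1}/w/= mulr1 lerDl mulr_ge0.
Qed.

(** Each feasible alpha yields a distribution in the ball, so N times the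
    supremum bounds all sums of the alpha_i; knapsack duality then returns
    lambda and s.  The nearest points make s_i + lambda * D_i >= 1 equivalent to
    the bound at all points of F `&` Xi. *)
Lemma strong_duality (R : realType) (m N : nat) (nrm : 'cV[R]_m -> R)
    (Xi F : set 'cV[R]_m) (xihat : 'I_N -> borel_cV R m) (eps : R) :
  is_norm nrm -> (0 < N)%N -> closed F -> closed Xi -> F `&` Xi !=set0 ->
  (forall i, Xi (xihat i)) -> 0 <= eps ->
  exists (lambda : R) (s : 'I_N -> R), [/\ 0 <= lambda, forall i, 0 <= s i,
    forall i xi, (F `&` Xi) xi -> 1 <= s i + lambda * nrm (xi - xihat i) &
    ((lambda * eps + N%:R^-1 * \sum_i s i)%:E <= ereal_sup [set Q F |
      Q in wasserstein_ball nrm Xi (empirical R xihat) eps])%E].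
Proof.
move=> hn N0 cF cXi FXi0 Xixi eps0.
have near i : exists z, (F `&` Xi) z /\ forall y, (F `&` Xi) y ->
    nrm (z - xihat i) <= nrm (y - xihat i).
  have [z Fz Hz] := nearest_point (xihat i) hn (closedI cF cXi) FXi0.
  by exists z.
have {near}[zeta zetaP] := choice near.
set V := ereal_sup _.
have Nr : 0 < N%:R :> R by rewrite ltr0n.
have Vub alpha : (forall i, 0 <= alpha i <= 1) ->
    \sum_i nrm (zeta i - xihat i) * alpha i <= N%:R * eps ->
    ((N%:R^-1 * \sum_i alpha i)%:E <= V)%E.
  move=> a01 aeps.
  have [||Q QB] := @transport_plan _ _ _ _ Xi F xihat zeta eps alpha
      hn N0 Xixi _ a01.
  - by move=> i; case: (zetaP i).
  - by rewrite ler_pdivrMl.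
  by move=> aQ; apply: (le_trans aQ); apply: ereal_sup_ubound; exists Q.
have V0 : (0 <= V)%E.
  apply: le_trans (Vub (fun=> 0) _ _); first by rewrite big1 ?mulr0.
    by move=> i; rewrite lexx ler01.
  by rewrite big1 ?mulr_ge0// => i _; rewrite mulr0.
have V1 : (V <= 1)%E.
  apply: ge_ereal_sup => _ [Q _ <-]; apply: probability_le1.
  exact: measurable_closed_cV.
have Vfin : V \is a fin_num.
  by rewrite ge0_fin_numE// (le_lt_trans V1)// ltry.
have [||l [s [l0 s0 sl lV]]] := @knapsack_duality _ _
    (fun i => nrm (zeta i - xihat i)) (N%:R * eps) (N%:R * fine V).
- by rewrite mulr_ge0.
- move=> alpha a01 aeps; rewrite -ler_pdivrMl// -lee_fin fineK//.
  exact: Vub.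
exists l, s; split=> // [i xi Fxi|].
  by rewrite (le_trans (sl i))// lerD2l ler_wpM2l//; exact: (zetaP i).2.
rewrite -[leRHS]fineK// lee_fin -(ler_pM2l Nr) mulrDr mulVKf ?gt_eqF//.
by rewrite mulrCA.
Qed.

(** * The dual programs *)

(** The pairs (lambda, s) with 1 <= s_i + lambda * nrm (xi - xihat_i) for all xi in
    F `&` Xi are exactly those that extend to a feasible point of the program:
    each polyhedron of the union contributes one family of multipliers. *)
Lemma worst_case_probability (R : realType) (m N L p K : nat)
    (nrm : 'cV[R]_m -> R) (C : 'M[R]_(L, m)) (d : 'cV[R]_L)
    (xihat : 'I_N -> borel_cV R m) (eps : R) (F : set 'cV[R]_m)
    (M : 'I_K -> 'M[R]_(p, m)) (h : 'I_K -> 'cV[R]_p) :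
  is_norm nrm -> (0 < N)%N -> (forall i, closed_polytope C d (xihat i)) ->
  0 <= eps -> (0 < K)%N -> closed F ->
  F = \bigcup_(k in [set: 'I_K]) closed_polytope (M k) (h k) ->
  (forall k, closed_polytope (M k) (h k) `&` closed_polytope C d !=set0) ->
  ereal_sup [set Q F | Q in
    wasserstein_ball nrm (closed_polytope C d) (empirical R xihat) eps] =
  ereal_inf [set v | exists (lambda : R) (s : 'I_N -> R)
      (theta : 'I_N -> 'I_K -> 'cV[R]_p) (gamma : 'I_N -> 'I_K -> 'cV[R]_L),
    [/\ forall i k, lev 0 (theta i k), forall i k, lev 0 (gamma i k),
        forall i k, 1 + dotv (theta i k) (h k - M k *m xihat i)
          + dotv (gamma i k) (d - C *m xihat i) <= s i,
        forall i k, (dual_norm nrm ((M k)^T *m theta i k + C^T *m gamma i k)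
          <= lambda%:E)%E
      & forall i, 0 <= s i]
    /\ v = (lambda * eps + N%:R^-1 * \sum_(i < N) s i)%:E].
Proof.
move=> hn N0 Xixi eps0 K0 cF FE P0; set Xi := closed_polytope C d.
have cXi : closed Xi by exact: closed_closed_polytope.
have mXi : measurable (Xi : set (borel_cV R m)) by exact: measurable_closed_cV.
have mF : measurable (F : set (borel_cV R m)) by exact: measurable_closed_cV.
apply/eqP; rewrite eq_le; apply/andP; split.
  apply: le_ereal_inf_tmp => _ [l [s [theta [gamma [[t0 g0 ts tl s0] ->]]]]].
  apply: ge_ereal_sup => _ [Q QB <-].
  apply: (weak_duality hn mXi mF Xixi _ s0 _ QB).
    have := tl (Ordinal N0) (Ordinal K0); rewrite -lee_fin.
    by apply: le_trans; exact: dual_norm_ge0.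
  move=> i xi [Fxi Xixi']; move: Fxi; rewrite FE => -[k _ Mxi].
  by apply: (certificate_sound hn (t0 i k) (g0 i k) (ts i k) (tl i k)); split.
have FXi0 : F `&` Xi !=set0.
  have [x [Mx Xx]] := P0 (Ordinal K0); exists x; split=> //.
  by rewrite FE; exists (Ordinal K0).
have [l [s [l0 s0 sF lV]]] := strong_duality hn N0 cF cXi FXi0 Xixi eps0.
apply: le_trans lV; apply: ereal_inf_lbound.
have cert (ik : 'I_N * 'I_K) : exists tg : 'cV[R]_p * 'cV[R]_L,
    [/\ lev 0 tg.1, lev 0 tg.2,
        1 + dotv tg.1 (h ik.2 - M ik.2 *m xihat ik.1)
          + dotv tg.2 (d - C *m xihat ik.1) <= s ik.1 &
        (dual_norm nrm ((M ik.2)^T *m tg.1 + C^T *m tg.2) <= l%:E)%E].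
  have [|t [g [t0 g0 tg tl]]] := @certificate_complete _ _ _ _ nrm (M ik.2)
      (h ik.2) C d (xihat ik.1) l (s ik.1) hn l0 (P0 _).
    by move=> x [Mx Xx]; apply: sF; split=> //; rewrite FE; exists ik.2.
  by exists (t, g).
have [tg tgP] := choice cert.
exists l, s, (fun i k => (tg (i, k)).1), (fun i k => (tg (i, k)).2).
by split=> //; split=> // i k; case: (tgP (i, k)).
Qed.

Unset Implicit Arguments.

Theorem corollary5p3 (R : realType) (m N L : nat)
    (nrm : 'cV[R]_m -> R) (hnrm : is_norm nrm)
    (C : 'M[R]_(L, m)) (d : 'cV[R]_L)
    (xihat : 'I_N -> borel_cV R m) (hN : (0 < N)%N)
    (hxihat : forall i, closed_polytope C d (xihat i))
    (eps : R) (heps : 0 <= eps) :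
  let Xi := closed_polytope C d in
  let B := wasserstein_ball nrm Xi (empirical R xihat) eps in
  (forall (K : nat) (A : 'M[R]_(K, m)) (b : 'cV[R]_K), (0 < K)%N ->
    (forall k : 'I_K,
      [set xi | b k 0 <= dotv (rowv A k) xi] `&` Xi !=set0) ->
    ereal_sup [set Q (~` open_polytope A b) | Q in B] =
    ereal_inf [set v | exists (lambda : R) (s : 'I_N -> R)
        (gamma : 'I_N -> 'I_K -> 'cV[R]_L) (theta : 'I_N -> 'I_K -> R),
      [/\ forall i k,
            1 - theta i k * (b k 0 - dotv (rowv A k) (xihat i))
              + dotv (gamma i k) (d - C *m xihat i) <= s i,
          forall i k,
            (dual_norm nrm (theta i k *: rowv A k - C^T *m gamma i k)
              <= lambda%:E)%E,
          forall i k, lev 0 (gamma i k),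
          forall i k, 0 <= theta i k
        & forall i, 0 <= s i]
      /\ v = (lambda * eps + N%:R^-1 * \sum_(i < N) s i)%:E])
  /\
  (forall (K : nat) (A : 'M[R]_(K, m)) (b : 'cV[R]_K),
    closed_polytope A b `&` Xi !=set0 ->
    ereal_sup [set Q (closed_polytope A b) | Q in B] =
    ereal_inf [set v | exists (lambda : R) (s : 'I_N -> R)
        (gamma : 'I_N -> 'cV[R]_L) (theta : 'I_N -> 'cV[R]_K),
      [/\ forall i,
            1 + dotv (theta i) (b - A *m xihat i)
              + dotv (gamma i) (d - C *m xihat i) <= s i,
          forall i,
            (dual_norm nrm (A^T *m theta i + C^T *m gamma i)
              <= lambda%:E)%E,
          forall i, lev 0 (gamma i),
          forall i, lev 0 (theta i)
        & forall i, 0 <= s i]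
      /\ v = (lambda * eps + N%:R^-1 * \sum_(i < N) s i)%:E]).
Proof.
move=> Xi B; split=> [K A b K0 P0|K A b P0]; last first.
  rewrite (@worst_case_probability _ _ _ _ K 1 nrm C d xihat eps _
    (fun=> A) (fun=> b))//; last 2 first.
  - exact: closed_closed_polytope.
  - apply/seteqP; split=> [x Ax|x [_ _ Ax]//]; by exists ord0.
  congr ereal_inf; apply/seteqP; split=> v.
    move=> [l [s [theta [gamma [[t0 g0 ts tl s0] ->]]]]].
    by exists l, s, (fun i => gamma i ord0), (fun i => theta i ord0).
  move=> [l [s [gamma [theta [[ts tl g0 t0 s0] ->]]]]].
  by exists l, s, (fun i _ => theta i), (fun i _ => gamma i).
(* The halfspace <a_k, xi> >= b_k is the polytope of the one-row matrix - a_k,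
   so that its multiplier is a vector of length one. *)
have halfE k : closed_polytope (- (rowv A k)^T) (- (b k 0)%:M) =
    [set xi | b k 0 <= dotv (rowv A k) xi].
  apply/seteqP; split=> x /=.
    by move=> /(_ 0); rewrite mulNmx !mxE mulr1n lerN2 /dotv mxE.
  move=> bx j; rewrite ord1 mulNmx [leLHS]mxE [leRHS]mxE lerN2.
  by rewrite [leLHS]mxE mulr1n.
rewrite (@worst_case_probability _ _ _ _ 1 K nrm C d xihat eps _
  (fun k => - (rowv A k)^T) (fun k => - (b k 0)%:M))//; last 3 first.
- exact: closed_setC_open_polytope.
- by rewrite setC_open_polytope; apply: eq_bigcupr => k _; rewrite halfE.
- by move=> k; rewrite halfE.
have scE i k (t : 'cV[R]_1) : dotv t (- (b k 0)%:M - - (rowv A k)^T *m xihat i) =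
    - (t 0 0 * (b k 0 - dotv (rowv A k) (xihat i))).
  rewrite dotvE big_ord1 -[ord0]/(0 : 'I_1) mulNmx -opprB opprK opprD opprK.
  by rewrite /dotv !mxE mulr1n -mulrN; congr (_ * _); ring.
have dnE k (t : 'cV[R]_1) g :
    dual_norm nrm ((- (rowv A k)^T)^T *m t + C^T *m g) =
    dual_norm nrm (t 0 0 *: rowv A k - C^T *m g).
  rewrite -[in RHS](dual_normN _ hnrm) opprB addrC; congr (dual_norm nrm _).
  rewrite linearN/= trmxK mulNmx; congr (_ - _).
  apply/colP => j; rewrite [in LHS]mxE big_ord1 [in RHS]mxE mulrC.
  by rewrite -[ord0]/(0 : 'I_1).
congr ereal_inf; apply/seteqP; split=> v.
  move=> [l [s [theta [gamma [[t0 g0 ts tl s0] ->]]]]].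
  exists l, s, gamma, (fun i k => theta i k 0 0); split=> //; split=> // i k.
  - by have := ts i k; rewrite scE.
  - by have := tl i k; rewrite dnE.
  - by have := t0 i k 0; rewrite mxE.
move=> [l [s [gamma [theta [[ts tl g0 t0 s0] ->]]]]].
exists l, s, (fun i k => (theta i k)%:M), gamma; split=> //; split=> // i k.
- by move=> j; rewrite ord1 !mxE mulr1n.
- by rewrite scE !mxE mulr1n.
- by rewrite dnE !mxE mulr1n.
Qed.
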